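(* Let $M:=\mathbb{C}^n/2\pi i\,\mathbb{Z}^n\simeq(\mathbb{C}^* )^n$. Let $h$ be a smooth Hermitian metric on the anti-canonical line bundle $K_M^{-1}$ (for example, one induced by a Hermitian metric on $M$) and let $\rho$ be the corresponding curvature form. (1) If $\rho\le 0$ then the $J$-volume functional evaluated on the canonical $n$-tori, $x\mapsto \mathrm{Vol}_J(L_x)$, is a convex function of $x\in\mathbb{R}^n$. (2) If $h$ is $\mathbb{T}^n$-invariant, then $\rho\le 0$ (respectively $\rho\ge 0$) if and only if the function $x\mapsto\log\mathrm{Vol}_J(L_x)$ is convex (respectively concave) on $\mathbb{R}^n$.
   Context: Write $z=x+iy$ for the coordinates on $\mathbb{C}^n/2\pi i\,\mathbb{Z}^n$, which is identified with $(\mathbb{C}^* )^n$ via $z\mapsto(e^{z_1},\dots,e^{z_n})$, so $x_i=\log r_i$, $y_i=\theta_i$. The group $\mathbb{T}^n=\mathbb{R}^n/2\pi\mathbb{Z}^n$ acts by translation in $y$. The canonical $n$-tori are $L_x=\{x\}\times(\mathbb{R}^n/2\pi\mathbb{Z}^n)$, $x\in\mathbb{R}^n$. $K_M=\Lambda^{n,0}M$, and $K_M^{-1}$ is its dual. Real tangent vectors are identified with elements of the holomorphic tangent bundle $T^{1,0}M$ in the usual way ($v\mapsto\frac12(v-iJv)$), so that for real vectors $v_1,\dots,v_n\in T_pM$, $v_1\wedge\dots\wedge v_n$ denotes an element of $K_M^{-1}|_p$. Curvature: for a Hermitian metric $h$ on a holomorphic line bundle and a local nowhere-vanishing holomorphic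 section $\sigma$, put $H=h(\sigma,\sigma)$. The curvature of the Chern connection is $\Theta=\bar\partial\partial\log H$, and $\rho:=i\Theta=-i\partial\bar\partial\log H$, a global closed real $(1,1)$-form. $\rho\ge 0$ ($\le 0$) means that $\rho(v,Jv)\ge 0$ ($\le 0$) for all real tangent vectors $v$. $J$-volume: an $n$-dimensional real submanifold $L\subset M$ is totally real if $T_pL\cap J(T_pL)=\{0\}$ for all $p\in L$. If $L$ is oriented and totally real and $v_1,\dots,v_n$ is a positive basis of $T_pL$ with dual basis $v_1^*,\dots,v_n^*$, define the $n$-form $\mathrm{vol}_J:=|v_1\wedge\dots\wedge v_n|_h\; v_1^*\wedge\dots\wedge v_n^*$ on $L$ (independent of the basis), and $\mathrm{Vol}_J(L):=\int_L\mathrm{vol}_J$. The canonical tori are totally real. *)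

(* Defs.v *)
From HB Require Import structures.
From mathcomp Require Import all_boot all_order all_algebra.
From mathcomp Require Import complex.
From mathcomp Require Import all_classical all_reals all_analysis.
Import Order.TTheory GRing.Theory Num.Theory.
Import numFieldNormedType.Exports.

Set Implicit Arguments.
Unset Strict Implicit.
Unset Printing Implicit Defensive.

Local Open Scope classical_set_scope.
Local Open Scope ring_scope.
Local Open Scope complex_scope.

(* The point (x, y) stands for z = x + iy in C^n. Objects on the quotient
   M = C^n / 2 pi i Z^n are represented by their lifts to C^n, i.e. by objects
   that are 2 pi Z^n-periodic in y. Since M has the global coordinates z, a real
   tangent vector at any point of M is likewise a pair (a, b), standing for
   \sum_k (a_k d/dx_k + b_k d/dy_k). *)
Definition pointC (R : realType) (n : nat) : normedModType R :=
  ('rV[R]_n * 'rV[R]_n)%type.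

Definition Jmap (R : realType) (n : nat) (v : pointC R n) : pointC R n :=
  (- v.2, v.1).

Definition dz (R : realType) (n : nat) (k : 'I_n) (v : pointC R n) : R[i] :=
  v.1 0 k +i* v.2 0 k.

Definition dxvec (R : realType) (n : nat) (k : 'I_n) : pointC R n :=
  (delta_mx 0 k, 0).

Definition dyvec (R : realType) (n : nat) (k : 'I_n) : pointC R n :=
  (0, delta_mx 0 k).

(* Real C^k functions: all iterated directional derivatives up to order k exist
   and are continuous. *)
Fixpoint Ck (R : realType) (V : normedModType R) (k : nat) (f : V -> R) : Prop :=
  continuous f /\
  match k with
  | 0 => True
  | k'.+1 => forall v : V,
      (forall p, derivable f p v) /\ Ck k' (fun p => 'D_v f p)
  end.

Definition smooth (R : realType) (V : normedModType R) (f : V -> R) : Prop :=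
  forall k, Ck k f.

Definition smoothC (R : realType) (V : normedModType R) (f : V -> R[i]) : Prop :=
  smooth (fun p => complex.Re (f p)) /\ smooth (fun p => complex.Im (f p)).

Definition periodic (R : realType) (n : nat) (T : Type)
    (f : pointC R n -> T) : Prop :=
  forall (x y : 'rV[R]_n) (m : 'rV[int]_n),
    f (x, y + (2 * pi) *: map_mx intr m) = f (x, y).

(* The fibre of K_M^{-1} = (Lambda^{n,0} M)^* at each point is identified with
   R[i] by means of the global holomorphic frame d/dz_1 ^ ... ^ d/dz_n dual to
   dz_1 ^ ... ^ dz_n; this frame is invariant under all translations, so periods
   and the T^n-action are trivial on the fibre coordinate. *)
Definition frame (R : realType) (n : nat) : pointC R n -> R[i] := fun=> 1.

(* The real vector v corresponds to
   (v - iJv)/2 = \sum_k dz_k(v) d/dz_k in T^{1,0}M. *)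
Definition wedge (R : realType) (n : nat) (v : 'I_n -> pointC R n) : R[i] :=
  \det (\matrix_(i < n, j < n) dz j (v i)).

Record hermitian_metric (R : realType) (n : nat) := HermitianMetric {
  hform :> pointC R n -> R[i] -> R[i] -> R[i] ;
  hform_linear : forall p (a s s' t : R[i]),
    hform p (a * s + s') t = a * hform p s t + hform p s' t ;
  hform_conj : forall p (s t : R[i]), hform p t s = (hform p s t)^* ;
  hform_gt0 : forall p (s : R[i]), s != 0 -> 0 < hform p s s ;
  hform_smooth : forall s t : R[i], smoothC (fun p => hform p s t) ;
  hform_periodic : periodic hform
}.

Definition hnorm (R : realType) (n : nat) (h : hermitian_metric R n)
    (p : pointC R n) (s : R[i]) : R :=
  Num.sqrt (complex.Re (h p s s)).

Definition Tinvariant (R : realType) (n : nat)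
    (h : hermitian_metric R n) : Prop :=
  forall x y t : 'rV[R]_n, h (x, y + t) = h (x, y) :> (R[i] -> R[i] -> R[i]).

Definition cderive (R : realType) (n : nat) (v : pointC R n)
    (f : pointC R n -> R[i]) (p : pointC R n) : R[i] :=
  'D_v (fun q => complex.Re (f q)) p +i* 'D_v (fun q => complex.Im (f q)) p.

Definition del (R : realType) (n : nat) (k : 'I_n)
    (f : pointC R n -> R[i]) (p : pointC R n) : R[i] :=
  (cderive (dxvec R k) f p - 'i * cderive (dyvec R k) f p) / 2.

Definition delbar (R : realType) (n : nat) (k : 'I_n)
    (f : pointC R n -> R[i]) (p : pointC R n) : R[i] :=
  (cderive (dxvec R k) f p + 'i * cderive (dyvec R k) f p) / 2.

Definition logH (R : realType) (n : nat) (h : hermitian_metric R n)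
    (sigma : pointC R n -> R[i]) (p : pointC R n) : R :=
  ln (complex.Re (h p (sigma p) (sigma p))).

(* delbar del u = \sum_(j, k) (delbar_k del_j u) dzbar_k ^ dz_j, with
   (alpha ^ beta)(v, w) = alpha(v) beta(w) - alpha(w) beta(v). *)
Definition delbar_del (R : realType) (n : nat) (u : pointC R n -> R)
    (p v w : pointC R n) : R[i] :=
  \sum_(j < n) \sum_(k < n)
    delbar k (del j (fun q => (u q)%:C)) p
    * ((dz k v)^* * dz j w - (dz k w)^* * dz j v).

(* The Chern curvature does not depend on the local nowhere-vanishing
   holomorphic section of K_M^{-1} used to compute it; here it is the global
   frame. *)
Definition Theta (R : realType) (n : nat) (h : hermitian_metric R n) :
    pointC R n -> pointC R n -> pointC R n -> R[i] :=
  delbar_del (logH h (@frame R n)).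

(* i Theta is a real form, which is why its real part is taken. *)
Definition rho (R : realType) (n : nat) (h : hermitian_metric R n)
    (p v w : pointC R n) : R :=
  complex.Re ('i * Theta h p v w).

Definition rho_ge0 (R : realType) (n : nat) (h : hermitian_metric R n) : Prop :=
  forall p v : pointC R n, 0 <= rho h p v (Jmap v).

Definition rho_le0 (R : realType) (n : nat) (h : hermitian_metric R n) : Prop :=
  forall p v : pointC R n, rho h p v (Jmap v) <= 0.

(* Integral over the cube [0, 2 pi]^n, a fundamental domain of R^n / 2 pi Z^n,
   as an iterated Lebesgue integral. *)
Fixpoint cube_integral (R : realType) (n : nat) : ('rV[R]_n -> R) -> R :=
  match n with
  | 0 => fun f => f 0
  | n'.+1 => fun f =>
      \int[lebesgue_measure]_(t in `[0, 2 * pi])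
        cube_integral (fun y : 'rV[R]_n' => f (row_mx t%:M y : 'rV[R]_(1 + n')))
  end.

(* For phi : R^n -> M, 2 pi Z^n-periodic and inducing an embedding of
   R^n / 2 pi Z^n with totally real image L: in the basis v_k = d phi / d theta_k
   of T L, the form vol_J pulls back to
   |v_1 ^ ... ^ v_n|_h d theta_1 ^ ... ^ d theta_n. *)
Definition VolJ (R : realType) (n : nat) (h : hermitian_metric R n)
    (phi : 'rV[R]_n -> pointC R n) : R :=
  cube_integral (fun theta =>
    hnorm h (phi theta) (wedge (fun k => 'D_(delta_mx 0 k) phi theta))).

Definition torus (R : realType) (n : nat) (x theta : 'rV[R]_n) : pointC R n :=
  (x, theta).

Definition convex (R : realType) (n : nat) (f : 'rV[R]_n -> R) : Prop :=
  convex_function (E := 'rV[R]_n) setT f.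

Definition concave (R : realType) (n : nat) (f : 'rV[R]_n -> R) : Prop :=
  convex (fun x => - f x).

(* Main.v *)
Require Import Defs.
From mathcomp Require Import all_boot all_order all_algebra.
From mathcomp Require Import all_classical all_reals all_analysis.
From mathcomp Require Import complex ring lra.
Import Order.TTheory GRing.Theory Num.Theory.
Import numFieldNormedType.Exports.

Set Implicit Arguments.
Unset Strict Implicit.
Unset Printing Implicit Defensive.

Local Open Scope classical_set_scope.
Local Open Scope ring_scope.

(** Write H for the squared norm of the invariant frame and u = ln H. The frame
    d/dtheta_1 ^ ... ^ d/dtheta_n of a canonical torus is i^n times the
    invariant frame, so the J-volume of L_x is the integral of exp (u / 2) over
    the fibre of points (x, theta).

    Computing i delbar del in real coordinates gives
    rho (v, Jv) = - (D_v D_v u + D_Jv D_Jv u) / 2 (rho_Jmap): the curvature is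
    nonpositive iff u has a nonnegative Levi form, i.e. is plurisubharmonic.

    For the first assertion, G = exp (u / 2) is again plurisubharmonic. For a
    direction a of R^n consider the second difference
    F (x + ra) + F (x - ra) - 2 F (x) of F (x) = VolJ (L_x). By periodicity the
    integral over theta of G (x, theta + ra) + G (x, theta - ra) - 2 G (x, theta)
    vanishes, so it may be added; with v = (a, 0) the integrand of the sum is
    then r^2 (D_v D_v G + D_Jv D_Jv G), up to o(r^2) uniformly in theta by
    compactness of the cube. Hence the second differences of F are bounded below
    by - o(r^2) (average_convex). Schwarz's classical lemma says that a
    continuous function with this property is convex (schwarz_convex). Working
    with second differences avoids differentiating under the integral sign.

    For the second assertion, u depends on x only and ln VolJ (L_x) is an affine
    increasing function of u (x, 0). The derivatives of u along the torus
    directions vanish, so D_v D_v u + D_Jv D_Jv u at v = (a, b) is the sum of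
    the Hessians of x |-> u (x, 0) at a and at b; it is nonnegative
    everywhere iff that function is convex (levi_ge0_convex). The concave case
    is the same statement for - u. *)

(** * Directional derivatives *)

Lemma is_derive_line (R : realType) (V : normedModType R) (f : V -> R)
    (p v : V) (s : R) :
  derivable f (s *: v + p) v ->
  is_derive s 1 (fun t => f (t *: v + p)) ('D_v f (s *: v + p)).
Proof.
have E : (fun h : R => h^-1 *: (f ((h *: (1 : R) + s) *: v + p) - f (s *: v + p))) =
    (fun h : R => h^-1 *: (f (h *: v + (s *: v + p)) - f (s *: v + p))).
  by apply/funext => h; rewrite scalerDl [h *: 1]mulr1 addrA.
move=> df; apply: DeriveDef; first by rewrite /derivable /= E.
by rewrite /derive /= E.
Qed.

Lemma is_derive_of_line (R : realType) (V : normedModType R) (f : V -> R)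
    (p v : V) (d : R) :
  is_derive (0 : R) 1 (fun t : R => f (t *: v + p)) d -> is_derive p v f d.
Proof.
have E : (fun h : R => h^-1 *: (f ((h *: (1 : R) + 0) *: v + p) - f (0 *: v + p))) =
    (fun h : R => h^-1 *: (f (h *: v + p) - f p)).
  by apply/funext => h; rewrite addr0 [h *: 1]mulr1 scale0r add0r.
move=> [+ <-]; rewrite /derivable /derive /= E => D.
by apply: DeriveDef.
Qed.

Lemma is_derive_comp1 (R : realType) (V : normedModType R) (f : V -> R)
    (g : R -> R) (p v : V) (d : R) :
  derivable f p v -> is_derive (f p) 1 g d ->
  is_derive p v (g \o f) (d * 'D_v f p).
Proof.
move=> df dg.
have df0 : derivable f (0 *: v + p) v by rewrite scale0r add0r.
have dl := is_derive_line df0.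
rewrite scale0r add0r in dl.
have dg' : is_derive ((fun t => f (t *: v + p)) 0) 1 g d.
  by rewrite scale0r add0r.
apply: is_derive_of_line; exact: (is_derive1_comp dg' dl).
Qed.

(** The mean value theorem for t |-> f (t s v + p) on [0, 1]; this
    parametrisation treats both signs of s at once. *)
Lemma MVT_line (R : realType) (V : normedModType R) (f : V -> R) (v p : V)
    (s : R) :
  (forall q, derivable f q v) ->
  exists2 t, `|t| <= `|s| & f (s *: v + p) - f p = s * 'D_v f (t *: v + p).
Proof.
move=> df.
have dl (t : R) : is_derive t 1 (fun t => f ((t * s) *: v + p))
    (s * 'D_v f ((t * s) *: v + p)).
  have d1 : is_derive (t * s) 1 (fun t => f (t *: v + p))
    ('D_v f ((t * s) *: v + p)) by apply: is_derive_line.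
  have d2 : is_derive t 1 (fun t : R => t * s) s.
    by apply: is_derive_eq; rewrite scaler0 add0r [s *: 1]mulr1.
  by rewrite mulrC; exact: (@is_derive1_comp _ _ (fun t : R => t * s) _ _ _ d1 d2).
have [|t t01 E] := @MVT _ _ _ 0 1 ltr01 (fun x _ => dl x).
  apply: derivable_within_continuous => x _; by have [] := dl x.
exists (t * s).
  move: t01; rewrite in_itv /= => /andP[t0 t1].
  by rewrite normrM (ger0_norm (ltW t0)) ler_piMl ?normr_ge0 ?(ltW t1).
by move: E; rewrite mul0r mul1r scale0r add0r subr0 mulr1.
Qed.

(** The map v |-> 'D_v f p is additive because the increment of f along
    h (v + w) is the increment along h v followed by one along h w, and by the
    mean value theorem the latter is h 'D_w f at a point tending to p. *)
Lemma is_deriveD_dir (R : realType) (V : normedModType R) (f : V -> R)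
    (v w p : V) :
  (forall q, derivable f q v) -> (forall q, derivable f q w) ->
  continuous ('D_w f) ->
  is_derive p (v + w) f ('D_v f p + 'D_w f p).
Proof.
move=> dv dw cw.
have /choice[xi xiP] : forall h : R, exists t, `|t| <= `|h| /\
    f (h *: w + (h *: v + p)) - f (h *: v + p) =
    h * 'D_w f (t *: w + (h *: v + p)).
  by move=> h; have [t] := MVT_line (h *: v + p) h dw; exists t.
have h0 : h @[h --> (0 : R)^'] --> (0 : R) by exact: cvg_within.
have xi0 : xi h @[h --> (0 : R)^'] --> (0 : R).
  apply/cvgrPdist_le => e e0; near=> h.
  rewrite sub0r normrN; apply: le_trans (xiP h).1 _.
  by near: h; exact: (cvgr0_norm_le _ h0).
have L : (fun h : R => h^-1 *: (f (h *: (v + w) + p) - f p)) @ 0^' -->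
    ('D_v f p + 'D_w f p : R).
  have L1 : h^-1 *: (f (h *: v + p) - f p) @[h --> 0^'] --> ('D_v f p : R).
    exact: (dv p).
  have L2 : 'D_w f (xi h *: w + (h *: v + p)) @[h --> 0^'] --> 'D_w f p.
    have -> : 'D_w f p = 'D_w f (0 *: w + (0 *: v + p)).
      by rewrite !scale0r !add0r.
    apply: (@cvg_comp _ _ _ (fun h : R => xi h *: w + (h *: v + p)) ('D_w f));
      last exact: cw.
    apply: cvgD; first exact: cvgZr_tmp.
    by apply: cvgD; [exact: cvgZr_tmp|exact: cvg_cst].
  apply: cvg_trans (cvgD L1 L2); apply: near_eq_cvg.
  near=> h.
  have h_neq0 : h != 0 by near: h; exact: nbhs_dnbhs_neq.
  have -> : h *: (v + w) + p = h *: w + (h *: v + p).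
    by rewrite scalerDr (addrC (h *: v)) addrA.
  have -> : f (h *: w + (h *: v + p)) - f p =
    (f (h *: w + (h *: v + p)) - f (h *: v + p)) + (f (h *: v + p) - f p).
    by rewrite [RHS]addrA subrK.
  by rewrite (xiP h).2 scalerDr addrC [_ *: (h * _)]mulKf.
apply: DeriveDef; first by apply/cvg_ex; eexists; exact: L.
exact: cvg_lim L.
Unshelve. all: by end_near. Qed.

Lemma is_deriveZ_dir (R : realType) (V : normedModType R) (f : V -> R)
    (v p : V) (c : R) :
  derivable f p v -> is_derive p (c *: v) f (c * 'D_v f p).
Proof.
move=> df.
have df0 : derivable f ((0 * c) *: v + p) v by rewrite mul0r scale0r add0r.
have d1 := is_derive_line df0.
have d2 : is_derive (0 : R) 1 (fun t : R => t * c) c.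
  by apply: is_derive_eq; rewrite scaler0 add0r [c *: 1]mulr1.
have := @is_derive1_comp _ _ (fun t : R => t * c) _ _ _ d1 d2.
rewrite mul0r scale0r add0r mulrC => d; apply: is_derive_of_line.
by under eq_fun do rewrite scalerA.
Qed.

Lemma is_deriveE (R : realType) (V : normedModType R) (f : V -> R) (p v : V)
    (d : R) :
  is_derive p v f d -> 'D_v f p = d.
Proof. by case. Qed.

(** * Functions of class C^k *)

Lemma Ck_continuous (R : realType) (V : normedModType R) k (f : V -> R) :
  Ck k f -> continuous f.
Proof. by case: k => [|k] []. Qed.

Lemma CkW (R : realType) (V : normedModType R) k (f : V -> R) :
  Ck k.+1 f -> Ck k f.
Proof.
elim: k f => [|k IH] f [cf df]; split => // v.
by have [d /IH] := df v.
Qed.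

Lemma Ck_derivable (R : realType) (V : normedModType R) k (f : V -> R) :
  Ck k.+1 f -> forall p v, derivable f p v.
Proof. by move=> [_ df] p v; have [] := df v. Qed.

Arguments Ck_derivable {R V k f} Cf p v.

Lemma Ck_derive (R : realType) (V : normedModType R) k (f : V -> R) v :
  Ck k.+1 f -> Ck k ('D_v f).
Proof. by move=> [_ /(_ v)[]]. Qed.

Lemma CkZ (R : realType) (V : normedModType R) k (c : R) (f : V -> R) :
  Ck k f -> Ck k (fun p => c * f p).
Proof.
elim: k f => [|k IH] f [cf df]; split => //; try by
  move=> p; apply: cvgM; [exact: cvg_cst|exact: cf].
move=> v; have [d df'] := df v.
have D p : is_derive p v (fun p => c * f p) (c * 'D_v f p).
  by have := derivableP (d p) => ?; exact: is_deriveZ.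
split => [p|]; first by have [] := D p.
rewrite (_ : (fun p => _) = (fun p => c * 'D_v f p)); first exact: IH.
by apply/funext => p; rewrite (is_deriveE (D p)).
Qed.

Lemma CkD (R : realType) (V : normedModType R) k (f g : V -> R) :
  Ck k f -> Ck k g -> Ck k (fun p => f p + g p).
Proof.
elim: k f g => [|k IH] f g [cf df] [cg dg]; split => //; try by
  move=> p; apply: cvgD; [exact: cf|exact: cg].
move=> v; have [d df'] := df v; have [e dg'] := dg v.
have D p : is_derive p v (fun p => f p + g p) ('D_v f p + 'D_v g p).
  by have := derivableP (d p) => ?; have := derivableP (e p) => ?; exact: is_deriveD.
split => [p|]; first by have [] := D p.
rewrite (_ : (fun p => _) = (fun p => 'D_v f p + 'D_v g p)); first exact: IH.
by apply/funext => p; rewrite (is_deriveE (D p)).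
Qed.

Lemma CkM (R : realType) (V : normedModType R) k (f g : V -> R) :
  Ck k f -> Ck k g -> Ck k (fun p => f p * g p).
Proof.
elim: k f g => [|k IH] f g Cf Cg.
  split => // p; apply: cvgM; [exact: Cf.1|exact: Cg.1].
split => [p|v].
  by apply: cvgM; [exact: (Ck_continuous Cf)|exact: (Ck_continuous Cg)].
have D p : is_derive p v (fun p => f p * g p) (f p * 'D_v g p + g p * 'D_v f p).
  have := derivableP (Ck_derivable Cf p v) => ?.
  have := derivableP (Ck_derivable Cg p v) => ?; exact: is_deriveM.
split => [p|]; first by have [] := D p.
rewrite (_ : (fun p => _) = (fun p => f p * 'D_v g p + g p * 'D_v f p)).
  by apply: CkD; apply: IH; by [exact: CkW|exact: Ck_derive].
by apply/funext => p; rewrite (is_deriveE (D p)).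
Qed.

Lemma is_derive_exp (R : realType) (V : normedModType R) (f : V -> R) p v :
  derivable f p v ->
  is_derive p v (fun p => expR (f p)) (expR (f p) * 'D_v f p).
Proof. by move=> d; exact: (is_derive_comp1 d (is_derive_expR _)). Qed.

Lemma Ck_exp (R : realType) (V : normedModType R) k (f : V -> R) :
  Ck k f -> Ck k (fun p => expR (f p)).
Proof.
elim: k f => [|k IH] f Cf; split => //; try by
  move=> p; apply: continuous_comp; [exact: (Ck_continuous Cf)|exact: continuous_expR].
move=> v; have D p := is_derive_exp (Ck_derivable Cf p v).
split => [p|]; first by have [] := D p.
rewrite (_ : (fun p => _) = (fun p => expR (f p) * 'D_v f p)).
  by apply: CkM; [exact/IH/CkW|exact: Ck_derive].
by apply/funext => p; rewrite (is_deriveE (D p)).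
Qed.

(** Induction on k needs the reciprocal of f, which is exp (- ln f); the
    closure under exp and the induction hypothesis then suffice. *)
Lemma Ck_ln (R : realType) (V : normedModType R) k (f : V -> R) :
  (forall p, 0 < f p) -> Ck k f -> Ck k (fun p => ln (f p)).
Proof.
move=> f0; elim: k f f0 => [|k IH] f f0 Cf; split => //; try by
  move=> p; apply: continuous_comp; [exact: (Ck_continuous Cf)|exact: continuous_ln].
move=> v.
have D p : is_derive p v (fun p => ln (f p)) (expR (- 1 * ln (f p)) * 'D_v f p).
  rewrite mulN1r expRN lnK ?posrE //.
  exact: (is_derive_comp1 (Ck_derivable Cf p v) (is_derive1_ln (f0 p))).
split => [p|]; first by have [] := D p.
rewrite (_ : (fun p => _) = (fun p => expR (- 1 * ln (f p)) * 'D_v f p)).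
  apply: CkM; last exact: Ck_derive.
  by apply/Ck_exp/CkZ/IH => //; exact: CkW.
by apply/funext => p; rewrite (is_deriveE (D p)).
Qed.

Lemma derive_scale (R : realType) (V : normedModType R) (c : R) (f : V -> R)
    (p v : V) :
  derivable f p v -> 'D_v (fun q => c * f q) p = c * 'D_v f p.
Proof. by move=> /derivableP d; apply: is_deriveE; exact: is_deriveZ. Qed.

Lemma derive_lincomb (R : realType) (V : normedModType R) (f : V -> R) m
    (c : 'I_m -> R) (e : 'I_m -> V) (p : V) :
  Ck 1 f -> 'D_(\sum_i c i *: e i) f p = \sum_i c i * 'D_(e i) f p.
Proof.
move=> Cf; elim: m c e => [|m IH] c e.
  rewrite !big_ord0 -(scale0r 0).
  rewrite (is_deriveE (is_deriveZ_dir 0 (Ck_derivable Cf p 0))).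
  by rewrite mul0r.
rewrite !big_ord_recr /=.
rewrite (is_deriveE (is_deriveD_dir p (Ck_derivable Cf ^~ _)
  (Ck_derivable Cf ^~ _) (Ck_continuous (Ck_derive _ Cf)))).
by rewrite IH (is_deriveE (is_deriveZ_dir _ (Ck_derivable Cf p _))).
Qed.

(** * Second differences and convexity *)

(** Taylor's formula with an exact remainder. With K chosen so that
    f t + f (- t) - K t^2 takes equal values at 0 and r, Rolle gives c with
    f' c - f' (- c) = 2 K c, and the mean value theorem for f' on [- c, c] then
    identifies K as a value of f''. *)
Lemma second_difference_real (R : realType) (f f' f'' : R -> R) (r : R) :
  (forall x : R, is_derive x 1 f (f' x)) -> (forall x : R, is_derive x 1 f' (f'' x)) ->
  0 < r ->
  exists2 t, `|t| <= r & f r + f (- r) - 2 * f 0 = r ^+ 2 * f'' t.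
Proof.
move=> df df' r0.
pose K := (f r + f (- r) - 2 * f 0) / r ^+ 2.
have r2 : r ^+ 2 != 0 by rewrite expf_neq0 ?gt_eqF.
have dN (g g' : R -> R) (x : R) : (forall x : R, is_derive x 1 g (g' x)) ->
    is_derive x 1 (fun x => g (- x)) (- g' (- x)).
  move=> dg; have d1 := dg (- x).
  have d2 : is_derive x 1 (fun x : R => - x) (- 1) by exact: is_deriveNid.
  by rewrite -mulN1r mulrC; exact: (@is_derive1_comp _ _ (fun x : R => - x) _ _ _ d1 d2).
pose g x := f x + f (- x) - K * x ^+ 2.
have dg (x : R) : is_derive x 1 g (f' x - f' (- x) - 2 * K * x).
  rewrite /g.
  have := df x; have := dN f f' x df => d1 d2.
  apply: is_derive_eq.
  by rewrite /GRing.scale /=; ring.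
have drv x : derivable g x 1 by have [] := dg x.
have [|| c] := @Rolle R g 0 r r0 (fun x _ => drv x).
- by apply: derivable_within_continuous => x _; have [] := dg x.
- by rewrite /g oppr0 expr0n /= mulr0 subr0 /K divfK //; ring.
rewrite in_itv /= => /andP[c0 cr] dc.
have := is_deriveE dc; rewrite (is_deriveE (dg c)) => Ec.
have cc : - c < c by rewrite gtrN.
have [|t] := @MVT R f' f'' (- c) c cc (fun x _ => df' x).
  by apply: derivable_within_continuous => x _; have [] := df' x.
rewrite in_itv /= => /andP[tc1 tc2] Et.
exists t; first by rewrite ler_norml; apply/andP; split; lra.
have : 2 * c * (f'' t - K) = 0 by move: Ec Et; rewrite opprK => Ec Et; nra.
move/eqP; rewrite !mulf_eq0 pnatr_eq0 /= gt_eqF //= subr_eq0 => /eqP ->.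
by rewrite /K [RHS]mulrC divfK.
Qed.

Lemma second_difference (R : realType) (V : normedModType R) (f : V -> R)
    (v p : V) (r : R) :
  Ck 2 f -> 0 < r ->
  exists2 t, `|t| <= r &
    f (r *: v + p) + f (- r *: v + p) - 2 * f p =
    r ^+ 2 * 'D_v ('D_v f) (t *: v + p).
Proof.
move=> [_ /(_ v)[df [_ /(_ v)[ddf _]]]] r0.
have := @second_difference_real R (fun t => f (t *: v + p)) _ _ r
  (fun t => is_derive_line (df _)) (fun t => is_derive_line (ddf _)) r0.
by rewrite scale0r add0r.
Qed.

(** Schwarz's lemma on [0, 1]. If f exceeded its chord by e > 0 at t, then
    f minus the chord minus e (s - s^2) would be positive at t and zero at the
    ends, hence maximal at an interior point c. The second difference there is at
    most 0, but the quadratic term contributes 2 e r^2, more than the e r^2 that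
    f can lose. *)
Lemma schwarz_chord (R : realType) (f : R -> R) :
  continuous f ->
  (forall x e : R, 0 < e -> \forall r \near (0 : R)^'+,
     - (e * r ^+ 2) <= f (x + r) + f (x - r) - 2 * f x) ->
  forall t, 0 <= t -> t <= 1 -> f t <= t * f 1 + (1 - t) * f 0.
Proof.
move=> cf sf t t0 t1; rewrite leNgt; apply/negP => ft.
pose e := f t - (t * f 1 + (1 - t) * f 0).
have e0 : 0 < e by rewrite subr_gt0.
pose h s := f s - (s * f 1 + (1 - s) * f 0) - e * (s - s ^+ 2).
have ch : continuous h.
  move=> s; apply: cvgB; first (apply: cvgB; first exact: cf).
    apply: cvgD; apply: cvgMr_tmp; first exact: cvg_id.
    by apply: cvgB; [exact: cvg_cst|exact: cvg_id].
  by apply: cvgMl_tmp; apply: cvgB; [exact: cvg_id|exact: exprn_continuous].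
have [c] := EVT_max (@ler01 R) (continuous_subspaceT ch).
rewrite in_itv /= => /andP[c0 c1] hc.
have ht : 0 < h t.
  rewrite /h -/e.
  have -> : e - e * (t - t ^+ 2) = e * ((t - 1 / 2) ^+ 2 + 3 / 4) by field.
  by rewrite mulr_gt0 // ltr_wpDl ?sqr_ge0 // divr_gt0.
have hc0 : 0 < h c by apply: lt_le_trans ht (hc _ _); rewrite in_itv /= t0.
have {}c0 : 0 < c.
  rewrite lt_neqAle c0 andbT; apply/eqP => cE; move: hc0; rewrite -cE /h.
  by rewrite !expr2; lra.
have {}c1 : c < 1.
  rewrite lt_neqAle c1 andbT; apply/eqP => cE; move: hc0; rewrite cE /h.
  by rewrite !expr2; lra.
have [r [r0 rc r1 sr]] : exists r, [/\ 0 < r, r <= c, r <= 1 - c &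
    - (e * r ^+ 2) <= f (c + r) + f (c - r) - 2 * f c].
  near (0 : R)^'+ => r; exists r; split; near: r.
  - exact: nbhs_right_gt.
  - exact: nbhs_right_le.
  - by apply: nbhs_right_le; rewrite subr_gt0.
  - exact: sf.
have h1 : h (c + r) <= h c by apply: hc; rewrite in_itv /=; apply/andP; split; lra.
have h2 : h (c - r) <= h c by apply: hc; rewrite in_itv /=; apply/andP; split; lra.
have : 0 < e * r ^+ 2 by rewrite mulr_gt0 // exprn_gt0.
have : h (c + r) + h (c - r) - 2 * h c =
  f (c + r) + f (c - r) - 2 * f c + 2 * (e * r ^+ 2) by rewrite /h; ring.
by lra.
Unshelve. all: by end_near. Qed.

Lemma convexP (R : realType) n (F : 'rV[R]_n -> R) :
  convex F <-> forall (t : R) a b, 0 <= t -> t <= 1 ->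
    F (t *: a + (1 - t) *: b) <= t * F a + (1 - t) * F b.
Proof.
split => [cF t a b t0 t1|H t a b _ _].
  have t01 : 0 <= t <= 1 by rewrite t0.
  have := cF (Itv01 t0 t1) a b.
  by rewrite !inE; apply.
by apply: H; [exact: ge0|exact: le1].
Qed.

Lemma schwarz_convex (R : realType) n (F : 'rV[R]_n -> R) :
  continuous F ->
  (forall (p v : 'rV[R]_n) (e : R), 0 < e -> \forall r \near (0 : R)^'+,
     - (e * r ^+ 2) <= F (r *: v + p) + F (- r *: v + p) - 2 * F p) ->
  convex F.
Proof.
move=> cF sF; apply/convexP => t a b t0 t1.
pose f s := F (s *: (a - b) + b).
have := @schwarz_chord R f _ _ t t0 t1.
rewrite /f scale1r subrK scale0r add0r.
have -> : t *: a + (1 - t) *: b = t *: (a - b) + b.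
  by rewrite scalerBl scalerBr scale1r addrA addrAC.
apply.
  move=> s; apply: (@cvg_comp _ _ _ (fun s : R => s *: (a - b) + b) F); last exact: cF.
  by apply: cvgD; [apply: cvgZr_tmp; exact: cvg_id|exact: cvg_cst].
move=> x e e0; apply: filterS (sF (x *: (a - b) + b) (a - b) e e0) => r.
by rewrite (addrC x r) (addrC x (- r)) !(scalerDl (a - b)) !addrA.
Qed.

Lemma convex_second_difference (R : realType) n (F : 'rV[R]_n -> R) p v (r : R) :
  convex F -> 0 <= F (r *: v + p) + F (- r *: v + p) - 2 * F p.
Proof.
move=> /convexP H.
have := H (1 / 2) (r *: v + p) (- r *: v + p).
have -> : (1 / 2) *: (r *: v + p) + (1 - 1 / 2) *: (- r *: v + p) = p.
  have -> : (1 - 1 / 2 : R) = 1 / 2 by field.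
  rewrite -scalerDr scaleNr addrACA subrr add0r -[p + p]mulr2n -(scaler_nat 2 p) scalerA.
  by rewrite mul1r mulVf ?pnatr_eq0 // scale1r.
by move=> /(_ _ _); lra.
Qed.

Lemma convex_ext (R : realType) n (F G : 'rV[R]_n -> R) :
  F =1 G -> convex F <-> convex G.
Proof. by move=> /funext ->. Qed.

Lemma convex_affine (R : realType) n (F : 'rV[R]_n -> R) (c k : R) :
  0 < k -> convex (fun x => c + k * F x) <-> convex F.
Proof.
move=> k0; split => /convexP H; apply/convexP => t a b t0 t1.
  by rewrite -(ler_pM2l k0); have := H t a b t0 t1; lra.
by have := H t a b t0 t1; rewrite -(ler_pM2l k0); lra.
Qed.

(** * Integration over intervals *)

Lemma continuous_pair (P X Y : topologicalType) (f : P -> X) (g : P -> Y) :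
  continuous f -> continuous g -> continuous (fun p => (f p, g p)).
Proof. by move=> cf cg p; exact: (cvg_pair (cf p) (cg p)). Qed.

Lemma continuous_of_comp (P X Y : topologicalType) (f : P -> X) (g : X -> Y) :
  continuous f -> continuous g -> continuous (fun p => g (f p)).
Proof. by move=> cf cg p; apply: continuous_comp; [exact: cf|exact: cg]. Qed.

Lemma continuous_slice (P X Y : topologicalType) (f : P * X -> Y) (p : P) :
  continuous f -> continuous (fun x => f (p, x)).
Proof.
move=> cf; apply: (@continuous_of_comp _ _ _ (fun x => (p, x)) f) => //.
by apply: continuous_pair; [move=> x; exact: cvg_cst|move=> x; exact: cvg_id].
Qed.

Lemma continuous_fun_add (R : realType) (P : topologicalType)
    (V : normedModType R) (f g : P -> V) :
  continuous f -> continuous g -> continuous (fun p => f p + g p).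
Proof. by move=> cf cg p; apply: cvgD; [exact: cf|exact: cg]. Qed.

Lemma continuous_fun_scale (R : realType) (P : topologicalType)
    (V : normedModType R) (f : P -> R) (g : P -> V) :
  continuous f -> continuous g -> continuous (fun p => f p *: g p).
Proof. by move=> cf cg p; apply: cvgZ; [exact: cf|exact: cg]. Qed.

(** The tube lemma, in the form of locally uniform dependence on a parameter. *)
Lemma compact_near_uniform (R : realType) (P X : topologicalType) (K : set X)
    (f : P * X -> R) (p0 : P) (e : R) :
  compact K -> continuous f -> 0 < e ->
  \forall p \near p0, forall x, K x -> `|f (p, x) - f (p0, x)| <= e.
Proof.
move=> /compact_near_coveringP cK cf e0.
apply: (cK _ (nbhs p0) (fun p x => `|f (p, x) - f (p0, x)| <= e)) => x Kx.
have c1 : f (z.2, z.1) @[z --> (x, p0)] --> f (p0, x).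
  apply: (@cvg_comp _ _ _ (fun z : X * P => (z.2, z.1)) f); last exact: cf.
  by apply: cvg_pair; [exact: cvg_snd|exact: cvg_fst].
have c2 : f (p0, z.1) @[z --> (x, p0)] --> f (p0, x).
  apply: (@cvg_comp _ _ _ (fun z : X * P => (p0, z.1)) f); last exact: cf.
  by apply: cvg_pair; [exact: cvg_cst|exact: cvg_fst].
have c0 : f (z.2, z.1) - f (p0, z.1) @[z --> (x, p0)] --> (0 : R).
  by rewrite -(subrr (f (p0, x))); exact: cvgB c1 c2.
exact: cvgr0_norm_le c0 _ e0.
Qed.

Section interval.
Context {R : realType}.
Local Notation mu := (@lebesgue_measure R).

Lemma continuous_itv_integrable (f : R -> R) (a b : R) :
  continuous f -> mu.-integrable `[a, b] (EFin \o f).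
Proof.
move=> cf; apply: continuous_compact_integrable; first exact: segment_compact.
exact: continuous_subspaceT.
Qed.

Lemma Rintegral_itv_cst (a b c : R) : a <= b ->
  \int[mu]_(t in `[a, b]) c = (b - a) * c.
Proof.
move=> ab; rewrite Rintegral_cst //= lebesgue_measure_itv /= lte_fin mulrC.
case: ifPn => [_|]; first by rewrite EFinN.
by rewrite -leNgt => ba; rewrite (le_anti (introT andP (conj ab ba))) subrr.
Qed.

Lemma continuous_Rintegral (P : topologicalType) (f : P -> R -> R) (a b : R) :
  a <= b -> continuous (fun z : P * R => f z.1 z.2) ->
  continuous (fun p => \int[mu]_(t in `[a, b]) f p t).
Proof.
move=> ab cf p0; apply/cvgrPdist_le => e e0 /=.
have cfp p : continuous (f p).
  exact: (@continuous_slice _ _ _ (fun z : P * R => f z.1 z.2) p cf).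
have e1 : 0 < e / (b - a + 1) by rewrite divr_gt0 // ltr_wpDl // subr_ge0.
have := compact_near_uniform p0 (@segment_compact R a b) cf e1.
apply: filterS => p /= H.
rewrite -RintegralB //; try exact: continuous_itv_integrable.
have cB : continuous (fun t => f p0 t - f p t).
  by move=> t; apply: cvgB; exact: cfp.
apply: le_trans (le_normr_Rintegral _ (continuous_itv_integrable a b cB)) _ => //.
apply: (@le_trans _ _ (\int[mu]_(t in `[a, b]) (e / (b - a + 1)))).
  apply: le_Rintegral => //; try apply: continuous_itv_integrable.
  - by move=> t; apply: cvg_norm; exact: cB.
  - by move=> t; exact: cvg_cst.
  - by move=> t /H; rewrite distrC.
rewrite Rintegral_itv_cst // mulrA ler_pdivrMr ?ltr_wpDl ?subr_ge0 // mulrC.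
by rewrite ler_pM2l // lerDl.
Qed.

Lemma Rintegral_FTC (f F : R -> R) (a b : R) : a < b -> continuous f ->
  (forall x, a <= x -> is_derive x 1 F (f x)) ->
  \int[mu]_(t in `[a, b]) f t = F b - F a.
Proof.
move=> ab cf dF.
have cF x : a <= x -> {for x, continuous F}.
  move=> ax; apply/differentiable_continuous/derivable1_diffP.
  by have [] := dF x ax.
rewrite /Rintegral (@continuous_FTC2 _ f F) //.
- exact: continuous_subspaceT.
- split.
  + by move=> x; rewrite in_itv /= => /andP[/ltW ax _]; have [] := dF x ax.
  + exact/cvg_at_right_filter/cF.
  + exact/cvg_at_left_filter/cF/ltW.
- move=> x; rewrite in_itv /= => /andP[/ltW ax _].
  by rewrite derive1E; exact: is_deriveE (dF x ax).
Qed.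

Lemma continuous_antiderivative (f : R -> R) (a : R) : continuous f ->
  exists F : R -> R, forall x, a < x -> is_derive x 1 F (f x).
Proof.
move=> cf; exists (fun x => \int[mu]_(t in `[a, x]) f t) => x ax.
have x1 : x < x + 1 by rewrite ltrDl.
have [d] := continuous_FTC1_closed x1 (continuous_itv_integrable a (x + 1) cf) ax (cf x).
by rewrite derive1E => <-; exact: derivableP.
Qed.

(** If F is an antiderivative of f, the integral of f over [c, c + L] is
    F (c + L) - F c, whose derivative in c is f (c + L) - f c = 0. *)
Lemma Rintegral_periodic_shift (f : R -> R) (L c : R) :
  0 < L -> continuous f -> (forall t, f (t + L) = f t) ->
  \int[mu]_(t in `[0, L]) f (t + c) = \int[mu]_(t in `[0, L]) f t.
Proof.
move=> L0 cf fL.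
(* an antiderivative is only needed to the right of both c and 0 *)
pose a := Num.min c 0 - 1.
have ac : a < c by rewrite ltrBlDr; apply: le_lt_trans (_ : c < _);
  rewrite ?ge_min ?lexx ?ltrDl.
have a0 : a < 0 by rewrite subr_lt0 gt_min ltr01 orbT.
have [F dF] := continuous_antiderivative a cf.
have dshift (s x : R) : a < x + s -> is_derive x 1 (fun t => F (t + s)) (f (x + s)).
  move=> axs; have d1 := dF _ axs.
  have d2 : is_derive x 1 (fun t : R => t + s) 1 by exact: is_derive_shift.
  by have := @is_derive1_comp _ _ (fun t : R => t + s) _ _ _ d1 d2; rewrite mulr1.
pose D x := F (x + L) - F x.
have dD (x : R) : a < x -> is_derive x 1 D 0.
  move=> ax; rewrite /D.
  have d1 := dshift L x (lt_trans ax (ltr_pwDr L0 (lexx x))).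
  have d2 := dF x ax.
  by apply: is_derive_eq; rewrite fL subrr.
have Dcst x y : a < x -> x <= y -> D y = D x.
  move=> ax xy; apply/eqP; rewrite -subr_eq0; apply/eqP.
  have [||z _ ->] := @MVT_segment R D (fun=> 0) x y xy; last by rewrite mul0r.
    move=> z; rewrite in_itv /= => /andP[xz _]; exact/dD/(lt_trans ax).
  apply: derivable_within_continuous => z; rewrite in_itv /= => /andP[xz _].
  by have [] := dD z (lt_le_trans ax xz).
have -> : \int[mu]_(t in `[0, L]) f (t + c) = F (L + c) - F (0 + c).
  apply: (@Rintegral_FTC (fun t => f (t + c)) (fun t => F (t + c))) => //.
    move=> t; apply: (@cvg_comp _ _ _ (fun t => t + c) f); last exact: cf.
    by apply: cvgD; [exact: cvg_id|exact: cvg_cst].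
  by move=> x x0; apply: dshift; apply: lt_le_trans ac _; rewrite lerDr.
have -> : \int[mu]_(t in `[0, L]) f t = F L - F 0.
  apply: Rintegral_FTC => //.
  by move=> x x0; apply: dF; exact: lt_le_trans a0 x0.
rewrite add0r (addrC L) -/(D c) -{1}(add0r L) -/(D 0).
by have [c0|/ltW c0] := leP 0 c; [exact: Dcst|rewrite (Dcst c 0)].
Qed.

End interval.

(** * Integration over the cube *)

Lemma continuous_rV (R : realType) (P : topologicalType) n (f : P -> 'rV[R]_n) :
  (forall j, continuous (fun p => f p 0 j)) -> continuous f.
Proof.
move=> cf p; apply/cvgrPdist_le => /= e e0.
near=> x.
rewrite /Num.Def.normr/= mx_normrE (bigmax_le _ (ltW e0))//= => -[i j] _.
rewrite !mxE/= (ord1 i).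
move: j {i}; near: x; apply: filter_forall => /= j.
exact: ((cvgrPdist_le _ _).1 (cf j p)).
Unshelve. all: by end_near. Qed.

Lemma continuous_row_mx (R : realType) (P : topologicalType) n
    (f : P -> R) (g : P -> 'rV[R]_n) :
  continuous f -> continuous g ->
  continuous (fun p => row_mx (f p)%:M (g p) : 'rV[R]_(1 + n)).
Proof.
move=> cf cg; apply: continuous_rV => j.
rewrite -(fintype.splitK j); case: (fintype.split j) => k /=.
  by under eq_fun do rewrite row_mxEl !mxE ord1 eqxx mulr1n.
under eq_fun do rewrite row_mxEr.
apply: (@continuous_of_comp _ _ _ g (fun y : 'rV[R]_n => y 0 k) cg).
exact: coord_continuous.
Qed.

Section cube.
Context {R : realType}.
Local Notation mu := (@lebesgue_measure R).

Lemma pi2_gt0 : 0 < 2 * pi :> R.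
Proof. by rewrite mulr_gt0 // pi_gt0. Qed.

Definition cube n : set 'rV[R]_n := [set y | forall j, y 0 j \in `[0, 2 * pi]].

(** The parameter space is arbitrary because the induction on n turns the
    outermost integration variable into one more parameter. *)
Lemma continuous_cube_integral n (P : topologicalType) (f : P -> 'rV[R]_n -> R) :
  continuous (fun z : P * 'rV[R]_n => f z.1 z.2) ->
  continuous (fun p => cube_integral (f p)).
Proof.
elim: n P f => [|n IH] P f cf /=.
  apply: (@continuous_of_comp _ _ _ (fun p : P => (p, 0 : 'rV[R]_0))
    (fun z : P * 'rV[R]_0 => f z.1 z.2)) => //.
  by apply: continuous_pair; [move=> x; exact: cvg_id|move=> x; exact: cvg_cst].
apply: continuous_Rintegral; first exact/ltW/pi2_gt0.
pose g (z : P * R) (y : 'rV[R]_n) := f z.1 (row_mx z.2%:M y : 'rV[R]_(1 + n)).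
apply: (IH (P * R)%type g).
apply: (@continuous_of_comp _ _ _
  (fun w : P * R * 'rV[R]_n => (w.1.1, row_mx w.1.2%:M w.2 : 'rV[R]_(1 + n)))
  (fun z : P * 'rV[R]_(1 + n) => f z.1 z.2)) => //.
have c1 : continuous (@fst (P * R) 'rV[R]_n) by move=> w; exact: cvg_fst.
apply: continuous_pair.
  by apply: (@continuous_of_comp _ _ _ fst fst c1) => w; exact: cvg_fst.
apply: continuous_row_mx; last by move=> w; exact: cvg_snd.
by apply: (@continuous_of_comp _ _ _ fst snd c1) => w; exact: cvg_snd.
Qed.

Lemma continuous_cube_slice n (f : 'rV[R]_n.+1 -> R) :
  continuous f ->
  continuous (fun z : R * 'rV[R]_n => f (row_mx z.1%:M z.2 : 'rV[R]_(1 + n))).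
Proof.
move=> cf; apply: (@continuous_of_comp _ _ _
  (fun z : R * 'rV[R]_n => row_mx z.1%:M z.2 : 'rV[R]_(1 + n)) f) => //.
by apply: continuous_row_mx => w; [exact: cvg_fst|exact: cvg_snd].
Qed.

Lemma continuous_cube_slice1 n (f : 'rV[R]_n.+1 -> R) (t : R) :
  continuous f ->
  continuous (fun y : 'rV[R]_n => f (row_mx t%:M y : 'rV[R]_(1 + n))).
Proof.
by move/continuous_cube_slice; exact: (@continuous_slice _ _ _
  (fun z : R * 'rV[R]_n => f (row_mx z.1%:M z.2 : 'rV[R]_(1 + n))) t).
Qed.

Lemma cube_slice_integrable n (f : 'rV[R]_n.+1 -> R) :
  continuous f ->
  mu.-integrable `[0, 2 * pi] (EFin \o (fun t =>
    cube_integral (fun y : 'rV[R]_n => f (row_mx t%:M y : 'rV[R]_(1 + n))))).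
Proof.
move=> cf; apply: continuous_itv_integrable.
by apply: continuous_cube_integral; exact: continuous_cube_slice.
Qed.

Lemma cube_integralD n (f g : 'rV[R]_n -> R) : continuous f -> continuous g ->
  cube_integral (fun y => f y + g y) = cube_integral f + cube_integral g.
Proof.
elim: n f g => [//|n IH] f g cf cg /=.
rewrite -RintegralD //; try exact: cube_slice_integrable.
apply: eq_Rintegral => t _.
by rewrite -IH //; exact: continuous_cube_slice1.
Qed.

Lemma cube_integralZ n (k : R) (f : 'rV[R]_n -> R) : continuous f ->
  cube_integral (fun y => k * f y) = k * cube_integral f.
Proof.
elim: n f => [//|n IH] f cf /=.
rewrite -RintegralZl //; try exact: cube_slice_integrable.
apply: eq_Rintegral => t _.
by rewrite -IH //; exact: continuous_cube_slice1.
Qed.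

Lemma cube_integral_cst n (c : R) :
  cube_integral (fun _ : 'rV[R]_n => c) = (2 * pi) ^+ n * c.
Proof.
elim: n => [|n IH] /=; first by rewrite expr0 mul1r.
by rewrite IH Rintegral_itv_cst ?ltW ?pi2_gt0 // subr0 exprS mulrA.
Qed.

Lemma le_cube_integral n (f g : 'rV[R]_n -> R) : continuous f -> continuous g ->
  (forall y, cube y -> f y <= g y) -> cube_integral f <= cube_integral g.
Proof.
elim: n f g => [|n IH] f g cf cg fg /=; first by apply: fg => -[].
apply: le_Rintegral => //; try exact: cube_slice_integrable.
move=> t t01; apply: IH; try exact: continuous_cube_slice1.
move=> y cy; apply: fg.
suff H (j : 'I_(1 + n)) : (row_mx t%:M y : 'rV[R]_(1 + n)) 0 j \in `[0, 2 * pi].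
  by move=> j; exact: H.
rewrite -(fintype.splitK j); case: (fintype.split j) => k /=.
  by rewrite row_mxEl mxE ord1 eqxx.
by rewrite row_mxEr.
Qed.

Lemma compact_cube n : compact (@cube n).
Proof.
by apply: (@rV_compact R n (fun=> `[0, 2 * pi]%classic)) => _;
  exact: segment_compact.
Qed.

Definition rV_periodic n (f : 'rV[R]_n -> R) :=
  forall (y : 'rV[R]_n) (m : 'rV[int]_n),
    f (y + (2 * pi) *: map_mx intr m) = f y.

Lemma row_mx_translate n (a t : R) (k : int) (y : 'rV[R]_n) (m : 'rV[int]_n) :
  row_mx t%:M y + a *: map_mx intr (row_mx k%:M m) =
  row_mx (t + a * k%:~R)%:M (y + a *: map_mx intr m).
Proof.
by rewrite map_row_mx map_scalar_mx scale_row_mx scale_scalar_mx add_row_mx raddfD.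
Qed.

Lemma cube_integral_shift n (f : 'rV[R]_n -> R) (c : 'rV[R]_n) :
  continuous f -> rV_periodic f ->
  cube_integral (fun y => f (y + c)) = cube_integral f.
Proof.
elim: n f c => [|n IH] f c cf pf /=; first by rewrite [c]thinmx0 addr0.
pose G t := cube_integral (fun y : 'rV[R]_n => f (row_mx t%:M y : 'rV[R]_(1 + n))).
have cG : continuous G.
  by apply: continuous_cube_integral; exact: continuous_cube_slice.
have pG t : G (t + 2 * pi) = G t.
  rewrite /G; congr cube_integral; apply/funext => y.
  rewrite -[RHS](pf _ (row_mx 1%:M 0 : 'rV[int]_(1 + n))).
  congr f; rewrite [RHS](row_mx_translate (2 * pi) t 1 y 0).
  by rewrite mulr1 raddf0 scaler0 addr0.
rewrite -[RHS](Rintegral_periodic_shift (c 0 0) pi2_gt0 cG pG).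
apply: eq_Rintegral => t _.
pose c' : 'rV[R]_(1 + n) := c.
have cE : c' = row_mx (c 0 0)%:M (rsubmx c').
  rewrite -[LHS]hsubmxK; congr row_mx; apply/rowP => j.
  rewrite !ord1 !mxE eqxx mulr1n /c'; congr (c _ _); exact/val_inj.
rewrite /G -[RHS](IH _ (rsubmx c')).
- congr cube_integral; apply/funext => y; congr f.
  have : row_mx t%:M y + c' = row_mx (t + c 0 0)%:M (y + rsubmx c').
    by rewrite {1}cE add_row_mx raddfD.
  exact.
- exact: continuous_cube_slice1.
- move=> y m; rewrite -[RHS](pf _ (row_mx 0%:M m : 'rV[int]_(1 + n))).
  congr f; rewrite [RHS](row_mx_translate (2 * pi) _ 0 y m).
  by rewrite mulr0 addr0.
Qed.

End cube.

(** * Second derivatives *)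

Section second_order.
Context {R : realType} {V : normedModType R}.
Implicit Types (f : V -> R) (p v : V).

Lemma continuous_line p v : continuous (fun t : R => t *: v + p).
Proof.
by move=> t; apply: cvgD; [apply: cvgZr_tmp; exact: cvg_id|exact: cvg_cst].
Qed.

(** The points produced by the mean value theorem range over [- r, r]; this
    turns a property near 0 into one holding on all of [- r, r]. *)
Lemma near0_right (P : R -> Prop) : (\forall t \near (0 : R), P t) ->
  \forall r \near (0 : R)^'+, forall t, `|t| <= r -> P t.
Proof.
move=> /nbhs_ballP[d /= d0 dP]; near=> r => t tr; apply: dP.
rewrite /ball /= sub0r normrN; apply: le_lt_trans tr _.
by near: r; exact: nbhs_right_lt.
Unshelve. all: by end_near. Qed.

(** A negative second derivative would stay negative on a short segment, and
    the second difference there is r^2 times one of its values. *)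
Lemma derive2_ge0 f p v : Ck 2 f ->
  (forall r : R, 0 <= f (r *: v + p) + f (- r *: v + p) - 2 * f p) ->
  0 <= 'D_v ('D_v f) p.
Proof.
move=> Cf f0; rewrite leNgt; apply/negP => neg.
have c : continuous (fun t : R => 'D_v ('D_v f) (t *: v + p)).
  apply: (@continuous_of_comp _ _ _ (fun t : R => t *: v + p) ('D_v ('D_v f))
    (@continuous_line p v)).
  exact: Ck_continuous (Ck_derive v (Ck_derive v Cf)).
have : \forall t \near (0 : R), 'D_v ('D_v f) (t *: v + p) < 0.
  have := c 0; rewrite /continuous_at scale0r add0r => c0.
  exact: (cvgr_lt _ c0).
move=> /near0_right H.
have [r [r0 rH]] : exists r : R, 0 < r /\
    forall t, `|t| <= r -> 'D_v ('D_v f) (t *: v + p) < 0.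
  near (0 : R)^'+ => r; exists r; split; near: r; first exact: nbhs_right_gt.
  exact: H.
have [t tr E] := second_difference v p Cf r0.
have := f0 r; rewrite E leNgt pmulr_rlt0 ?exprn_gt0 // => /negP; apply.
exact: rH.
Unshelve. all: by end_near. Qed.

Lemma derive_invariant f v : (forall (s : R) p, f (s *: v + p) = f p) ->
  'D_v f = cst 0.
Proof.
move=> fv; apply/funext => p; apply: is_deriveE.
apply: is_derive_of_line; under eq_fun do rewrite fv.
exact: is_derive_cst.
Qed.

Lemma derive2N f p v : Ck 2 f ->
  'D_v ('D_v (fun q => - 1 * f q)) p = - 'D_v ('D_v f) p.
Proof.
move=> Cf.
have -> : 'D_v (fun q => - 1 * f q) = fun q => - 1 * 'D_v f q.
  by apply/funext => q; exact: derive_scale (Ck_derivable Cf q v).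
by rewrite (derive_scale _ (Ck_derivable (Ck_derive v Cf) p v)) mulN1r.
Qed.

Lemma derive2_expR f p v : Ck 2 f ->
  'D_v ('D_v (fun q => expR (2^-1 * f q))) p =
  expR (2^-1 * f p) * (2^-1 * 'D_v ('D_v f) p + (2^-1 * 'D_v f p) ^+ 2).
Proof.
move=> Cf; pose g q := 2^-1 * f q.
have Cg : Ck 2 g by exact: CkZ.
have Dg q : 'D_v g q = 2^-1 * 'D_v f q.
  exact: derive_scale (Ck_derivable Cf q v).
have -> : 'D_v (fun q => expR (2^-1 * f q)) = fun q => expR (g q) * 'D_v g q.
  by apply/funext => q; exact: (is_deriveE (is_derive_exp (Ck_derivable Cg q v))).
have d1 := is_derive_exp (Ck_derivable Cg p v).
have d2 := derivableP (Ck_derivable (Ck_derive v Cg) p v).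
have -> : 'D_v (fun q => expR (g q) * 'D_v g q) p =
    expR (g p) * 'D_v ('D_v g) p + 'D_v g p * (expR (g p) * 'D_v g p).
  exact: (is_deriveE (is_deriveM d1 d2)).
have -> : 'D_v ('D_v g) p = 2^-1 * 'D_v ('D_v f) p.
  have -> : 'D_v g = fun q => 2^-1 * 'D_v f q by apply/funext.
  exact: derive_scale (Ck_derivable (Ck_derive v Cf) p v).
rewrite Dg /g.
by move: (expR _) ('D_v ('D_v f) p) ('D_v f p) => a b c; ring.
Qed.

End second_order.

(** * The Levi form and the curvature *)

Lemma quadratic_expand (R : comPzRingType) m (a b A B : 'I_m -> R)
    (XX YX XY YY : 'I_m -> 'I_m -> R) :
  (forall j, A j = \sum_k (a k * XX j k + b k * YX j k)) ->
  (forall j, B j = \sum_k (a k * XY j k + b k * YY j k)) ->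
  \sum_j (a j * A j + b j * B j) = \sum_j \sum_k
    (a j * a k * XX j k + a j * b k * YX j k +
     b j * a k * XY j k + b j * b k * YY j k).
Proof.
move=> HA HB; apply: eq_bigr => j _; rewrite HA HB !mulr_sumr -big_split.
by apply: eq_bigr => k _ /=; ring.
Qed.

Section coordinates.
Context {R : realType} {n : nat}.
Implicit Types (u : pointC R n -> R) (p v : pointC R n).

Lemma pointC_basis v :
  v = \sum_j v.1 0 j *: dxvec R j + \sum_j v.2 0 j *: dyvec R j.
Proof.
have E1 (F G : 'I_n -> 'rV[R]_n) :
    \sum_j ((F j, G j) : pointC R n) = (\sum_j F j, \sum_j G j).
  rewrite [LHS]surjective_pairing; congr (_, _).
    by rewrite (big_morph (@fst 'rV[R]_n 'rV[R]_n) (id1 := 0) (op1 := +%R)).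
  by rewrite (big_morph (@snd 'rV[R]_n 'rV[R]_n) (id1 := 0) (op1 := +%R)).
have -> : \sum_j v.1 0 j *: dxvec R j = (v.1, 0) :> pointC R n.
  transitivity ((\sum_j v.1 0 j *: delta_mx 0 j, \sum_j v.1 0 j *: 0) : pointC R n).
    by rewrite -E1.
  by rewrite -row_sum_delta big1 // => j _; rewrite scaler0.
have -> : \sum_j v.2 0 j *: dyvec R j = (0, v.2) :> pointC R n.
  transitivity ((\sum_j v.2 0 j *: 0, \sum_j v.2 0 j *: delta_mx 0 j) : pointC R n).
    by rewrite -E1.
  by rewrite -row_sum_delta big1 // => j _; rewrite scaler0.
by case: v => a b; congr (_, _); rewrite ?addr0 ?add0r.
Qed.

Lemma derive_coord u p v : Ck 1 u ->
  'D_v u p = \sum_j (v.1 0 j * 'D_(dxvec R j) u p + v.2 0 j * 'D_(dyvec R j) u p).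
Proof.
move=> Cu; rewrite {1}[v]pointC_basis.
rewrite (is_deriveE (is_deriveD_dir p (Ck_derivable Cu ^~ _)
  (Ck_derivable Cu ^~ _) (Ck_continuous (Ck_derive _ Cu)))).
by rewrite !derive_lincomb // big_split.
Qed.

(** The two orders of mixed differentiation are kept apart because they also
    occur separately in i delbar del. *)
Lemma derive_coord2 u p v : Ck 2 u ->
  'D_v ('D_v u) p = \sum_j \sum_k
    (v.1 0 j * v.1 0 k * 'D_(dxvec R k) ('D_(dxvec R j) u) p +
     v.1 0 j * v.2 0 k * 'D_(dyvec R k) ('D_(dxvec R j) u) p +
     v.2 0 j * v.1 0 k * 'D_(dxvec R k) ('D_(dyvec R j) u) p +
     v.2 0 j * v.2 0 k * 'D_(dyvec R k) ('D_(dyvec R j) u) p).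
Proof.
move=> Cu.
pose g j q := v.1 0 j * 'D_(dxvec R j) u q + v.2 0 j * 'D_(dyvec R j) u q.
have E : 'D_v u = \sum_j g j.
  by apply/funext => q; rewrite fct_sumE; exact/derive_coord/CkW.
have d z : is_derive p v ('D_z u) ('D_v ('D_z u) p).
  by apply: derivableP; exact: (Ck_derivable (Ck_derive z Cu)).
have dj j : is_derive p v (g j)
    (v.1 0 j * 'D_v ('D_(dxvec R j) u) p + v.2 0 j * 'D_v ('D_(dyvec R j) u) p).
  by apply: is_deriveD; apply: is_deriveZ; exact: d.
transitivity ('D_v (\sum_j g j) p); first by congr ('D_v _ p).
transitivity (\sum_j (v.1 0 j * 'D_v ('D_(dxvec R j) u) p +
                      v.2 0 j * 'D_v ('D_(dyvec R j) u) p)).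
  exact: (is_deriveE (is_derive_sum dj)).
apply: (quadratic_expand
  (A := fun j => 'D_v ('D_(dxvec R j) u) p)
  (B := fun j => 'D_v ('D_(dyvec R j) u) p)
  (XX := fun j k => 'D_(dxvec R k) ('D_(dxvec R j) u) p)
  (YX := fun j k => 'D_(dyvec R k) ('D_(dxvec R j) u) p)
  (XY := fun j k => 'D_(dxvec R k) ('D_(dyvec R j) u) p)
  (YY := fun j k => 'D_(dyvec R k) ('D_(dyvec R j) u) p)) => j;
  exact: derive_coord p v (Ck_derive _ Cu).
Qed.

End coordinates.

Section complex_computations.
Context {R : realType}.
Implicit Types a b c d : R.

Lemma complex_mulE a b c d : ((a +i* b)%C : R[i]) * (c +i* d)%C =
  ((a * c - b * d) +i* (a * d + b * c))%C.
Proof. by []. Qed.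

Lemma complex_halfE a b : ((a +i* b)%C : R[i]) / 2 =
  ((2^-1 * a) +i* (2^-1 * b))%C.
Proof.
have two : (2 : R[i]) = (2 +i* 0)%C.
  by apply/eqP; rewrite eq_complex /= ?addr0 !eqxx.
have h : (2 : R[i]) != 0 by rewrite pnatr_eq0.
apply: (mulIf h); rewrite divfK // two complex_mulE !mulr0 subr0 add0r.
by rewrite ![_ * 2]mulrC !mulrA divff ?pnatr_eq0 // !mul1r.
Qed.

Lemma Re_sum (I : Type) (r : seq I) (P : pred I) (F : I -> R[i]) :
  complex.Re (\sum_(i <- r | P i) F i) = \sum_(i <- r | P i) complex.Re (F i).
Proof. by apply: (big_morph (@complex.Re R)) => [[? ?] [? ?]|]. Qed.

End complex_computations.

Section curvature.
Context {R : realType} {n : nat}.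
Implicit Types (u : pointC R n -> R) (p v : pointC R n).

Lemma del_real u j :
  del j (fun q => (u q)%:C)%C =
  (fun q => ((2^-1 * 'D_(dxvec R j) u q) +i* (- 2^-1 * 'D_(dyvec R j) u q))%C).
Proof.
apply/funext => q; rewrite /del /cderive /=.
rewrite !(@derive_cst R (pointC R n) R 0 q).
set X := 'D_(dxvec R j) u q; set Y := 'D_(dyvec R j) u q.
have -> : ((X +i* 0)%C : R[i]) - 'i * (Y +i* 0)%C = (X +i* - Y)%C.
  by apply/eqP; rewrite eq_complex /=; apply/andP; split; apply/eqP; ring.
by rewrite complex_halfE mulNr mulrN.
Qed.

Lemma delbar_del_algebra (XX YX XY YY : R) :
  (((2^-1 * XX) +i* (- 2^-1 * XY))%C + 'i * ((2^-1 * YX) +i* (- 2^-1 * YY))%C) / 2 =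
  ((4^-1 * (XX + YY)) +i* (4^-1 * (YX - XY)))%C.
Proof.
rewrite [X in X / 2](_ : _ = ((2^-1 * (XX + YY)) +i* (2^-1 * (YX - XY)))%C).
  rewrite complex_halfE !mulrA -invfM.
  by have -> : 2 * 2 = 4 :> R by ring.
by apply/eqP; rewrite eq_complex /=; apply/andP; split; apply/eqP; ring.
Qed.

Lemma delbar_del_real u p j k : Ck 2 u ->
  delbar k (del j (fun q => (u q)%:C))%C p =
  ((4^-1 * ('D_(dxvec R k) ('D_(dxvec R j) u) p + 'D_(dyvec R k) ('D_(dyvec R j) u) p))
   +i* (4^-1 * ('D_(dyvec R k) ('D_(dxvec R j) u) p - 'D_(dxvec R k) ('D_(dyvec R j) u) p)))%C.
Proof.
move=> Cu; rewrite del_real -delbar_del_algebra.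
have D w z c : 'D_w (fun q => c * 'D_z u q) p = c * 'D_w ('D_z u) p.
  by apply: derive_scale; exact: (Ck_derivable (Ck_derive z Cu)).
by congr ((Complex _ _ + 'i * Complex _ _) / 2); exact: D.
Qed.

Lemma curvature_algebra (XX YX XY YY a b c d : R) :
  complex.Re ('i * (((4^-1 * (XX + YY)) +i* (4^-1 * (YX - XY)))%C *
    ((a +i* b)%C^* * (- d +i* c)%C - (- b +i* a)%C^* * (c +i* d)%C))) =
  - 2^-1 * ((c * a * XX + c * b * YX + d * a * XY + d * b * YY) +
            (- d * - b * XX + - d * a * YX + c * - b * XY + c * a * YY)).
Proof. by rewrite /=; field. Qed.

Lemma dz_Jmap v k : dz k (Jmap v) = (- v.2 0 k +i* v.1 0 k)%C.
Proof. by rewrite /dz /= mxE. Qed.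

(** Polarisation of the Hermitian form i delbar del on (v, Jv). The real part
    of the coefficient is symmetric in x and y, its imaginary part is the
    difference of the two orders of mixed differentiation; the Hessians at v and
    at Jv together produce exactly these combinations. *)
Lemma Re_i_delbar_del u p v : Ck 2 u ->
  complex.Re ('i * delbar_del u p v (Jmap v)) =
  - 2^-1 * ('D_v ('D_v u) p + 'D_(Jmap v) ('D_(Jmap v) u) p).
Proof.
move=> Cu; rewrite (derive_coord2 p v Cu) (derive_coord2 p (Jmap v) Cu).
rewrite -big_split mulr_sumr /delbar_del mulr_sumr Re_sum.
apply: eq_bigr => j _; rewrite -big_split mulr_sumr mulr_sumr Re_sum.
apply: eq_bigr => k _; rewrite delbar_del_real // !dz_Jmap.
have J i : (Jmap v).1 0 i = - v.2 0 i by rewrite mxE.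
rewrite !J; exact: curvature_algebra.
Qed.

End curvature.

(** * The canonical tori *)

Section metric.
Context {R : realType} {n : nat}.
Context (h : hermitian_metric R n).
Local Notation u := (logH h (@frame R n)).

Lemma weight_gt0 p : 0 < complex.Re (h p 1 1).
Proof. by have := hform_gt0 h p (oner_neq0 _); rewrite ltcE => /andP[]. Qed.

Lemma Ck_logH k : Ck k u.
Proof. by apply: Ck_ln weight_gt0 _; exact: (hform_smooth h 1 1).1. Qed.

Lemma rho_Jmap p v :
  rho h p v (Jmap v) = - 2^-1 * ('D_v ('D_v u) p + 'D_(Jmap v) ('D_(Jmap v) u) p).
Proof. exact: (Re_i_delbar_del p v (Ck_logH 2)). Qed.

(** Sesquilinearity of the metric, the conjugate linearity in the second
    argument coming from Hermitian symmetry. *)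
Lemma hform_norm p (w : R[i]) : h p w w = w * (w^*)%C * h p 1 1.
Proof.
have h0 t : h p 0 t = 0.
  have := hform_linear h p 1 0 0 t; rewrite mulr0 addr0 mul1r => E.
  by apply: (addIr (h p 0 t)); rewrite add0r -E.
have hl s t : h p s t = s * h p 1 t.
  by have := hform_linear h p s 1 0 t; rewrite mulr1 addr0 h0 addr0.
rewrite (hl w w) (hform_conj h p w 1) (hl w 1) rmorphM /= -(hform_conj h p 1 1).
by rewrite mulrA.
Qed.

Lemma derive_torus (x v theta : 'rV[R]_n) : 'D_v (torus x) theta = (0, v).
Proof.
have L : s^-1 *: (torus x (s *: v + theta) - torus x theta) @[s --> (0 : R)^'] -->
    ((0, v) : pointC R n).
  apply: (@cvg_trans _ (cst ((0, v) : pointC R n) @ (0 : R)^')); last exact: cvg_cst.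
  apply: near_eq_cvg; near=> s.
  have s0 : s != 0 by near: s; exact: nbhs_dnbhs_neq.
  rewrite -[RHS]/((s^-1 *: (x - x), s^-1 *: (s *: v + theta - theta)) : pointC R n).
  by rewrite subrr scaler0 addrK scalerA mulVf // scale1r.
exact: cvg_lim L.
Unshelve. all: by end_near. Qed.

Lemma wedge_torus (x theta : 'rV[R]_n) :
  wedge (fun k => 'D_(delta_mx 0 k) (torus x) theta) = (0 +i* 1)%C ^+ n.
Proof.
rewrite /wedge (_ : \matrix_(i, j) _ = ((0 +i* 1)%C : R[i])%:M) ?det_scalar //.
apply/matrixP => i j; rewrite !mxE derive_torus /dz /= !mxE eqxx /= eq_sym.
by case: eqP => _.
Qed.

(** The frame of the torus is i^n times the invariant frame, hence has the
    same norm H^(1/2) = exp (u / 2). *)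
Lemma hnorm_torus (x theta : 'rV[R]_n) :
  hnorm h (torus x theta) (wedge (fun k => 'D_(delta_mx 0 k) (torus x) theta)) =
  expR (2^-1 * u (x, theta)).
Proof.
rewrite /hnorm hform_norm wedge_torus rmorphXn -exprMn_comm; last exact: mulrC.
rewrite (_ : (0 +i* 1)%C * ((0 +i* 1)%C^*)%C = 1 :> R[i]); last first.
  by apply/eqP; rewrite eq_complex /=; apply/andP; split; apply/eqP; ring.
rewrite expr1n mul1r.
have w0 := weight_gt0 (x, theta).
rewrite -[in LHS](lnK (w0 : _ \is Num.pos)).
have -> : ln (complex.Re (h (torus x theta) 1 1)) = 2%:R * (2^-1 * u (x, theta)).
  by rewrite mulrA divff ?pnatr_eq0 // mul1r.
by rewrite expRM_natl sqrtr_sqr ger0_norm // expR_ge0.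
Qed.

Lemma VolJ_torus x :
  VolJ h (torus x) = cube_integral (fun theta => expR (2^-1 * u (x, theta))).
Proof. by rewrite /VolJ; congr cube_integral; apply/funext => t; exact: hnorm_torus. Qed.

Lemma logH_periodic x : rV_periodic (fun theta => u (x, theta)).
Proof. by move=> y m; rewrite /logH hform_periodic. Qed.

End metric.

(** * Convexity from the Levi form *)

Section levi.
Context {R : realType} {n : nat}.
Implicit Types (u : pointC R n -> R) (p v : pointC R n).

(** Four times the Levi form of u, i.e. the Laplacian of u on the complex line
    through p in the direction v. *)
Definition levi u p v := 'D_v ('D_v u) p + 'D_(Jmap v) ('D_(Jmap v) u) p.

(** The chain rule adds squares of first derivatives, so exp (u / 2) is
    plurisubharmonic when u is. *)
Lemma levi_expR_ge0 u p v : Ck 2 u -> 0 <= levi u p v ->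
  0 <= levi (fun q => expR (2^-1 * u q)) p v.
Proof.
move=> Cu u0.
have -> : levi (fun q => expR (2^-1 * u q)) p v =
    expR (2^-1 * u p) * (2^-1 * levi u p v +
      ((2^-1 * 'D_v u p) ^+ 2 + (2^-1 * 'D_(Jmap v) u p) ^+ 2)).
  have dist (c x y s t : R) :
    c * (2^-1 * x + s) + c * (2^-1 * y + t) = c * (2^-1 * (x + y) + (s + t)) by ring.
  by rewrite -dist; congr (_ + _); exact: derive2_expR.
rewrite mulr_ge0 ?expR_ge0 // addr_ge0 //; first by rewrite mulr_ge0 // invr_ge0.
by rewrite addr_ge0 // sqr_ge0.
Qed.

Lemma leviN u p v : Ck 2 u -> levi (fun q => - 1 * u q) p v = - levi u p v.
Proof. by move=> Cu; rewrite [RHS]opprD; congr (_ + _); exact: derive2N. Qed.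

Lemma continuous_pairl (u : pointC R n -> R) (y : 'rV[R]_n) :
  continuous u -> continuous (fun x : 'rV[R]_n => u (x, y)).
Proof.
move=> cu; apply: (@continuous_of_comp _ _ _ (fun x : 'rV[R]_n => (x, y)) u) => //.
by apply: (@continuous_pair _ _ _ id (fun=> y));
  [move=> x; exact: cvg_id|exact: cst_continuous].
Qed.

(** When u does not depend on y, its Levi form in the direction (a, 0) is the
    Hessian of u (., 0) at a, as the contribution of J (a, 0) = (0, a) vanishes.
    Conversely convexity makes all second differences of u nonnegative. *)
Lemma levi_ge0_convex u : Ck 2 u -> (forall x y, u (x, y) = u (x, 0)) ->
  (forall p v, 0 <= levi u p v) <-> convex (fun x => u (x, 0)).
Proof.
move=> Cu uT; split => [L|cu]; last first.
  have D w p (r : R) : 0 <= u (r *: w + p) + u (- r *: w + p) - 2 * u p.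
    have E s : u (s *: w + p) = u (s *: w.1 + p.1, 0).
      by rewrite [in LHS](surjective_pairing (s *: w + p)) uT.
    have -> : u p = u (p.1, 0) by rewrite [in LHS](surjective_pairing p) uT.
    by rewrite !E; exact: (convex_second_difference p.1 w.1 r cu).
  by move=> p v; rewrite addr_ge0 //; apply: derive2_ge0.
apply: schwarz_convex => [|x a e e0].
  exact: continuous_pairl (Ck_continuous Cu).
near=> r.
have r0 : 0 < r by near: r; exact: nbhs_right_gt.
have [t _] := second_difference ((a, 0) : pointC R n) ((x, 0) : pointC R n) Cu r0.
have E s : s *: ((a, 0) : pointC R n) + (x, 0) = (s *: a + x, s *: 0 + 0) by [].
rewrite !E !(uT _ (_ *: 0 + 0)) => ->.
apply: (@le_trans _ _ 0); first by rewrite oppr_le0 mulr_ge0 ?sqr_ge0 // ltW.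
rewrite mulr_ge0 ?sqr_ge0 //.
have := L ((t *: a + x, t *: 0 + 0)) (a, 0); rewrite /levi.
have -> : 'D_(Jmap (a, 0)) u = cst 0.
  apply: derive_invariant => s [x' y'].
  have -> : s *: (Jmap (a, 0) : pointC R n) + (x', y') = (x', s *: a + y').
    by rewrite -[LHS]/(s *: - 0 + x', s *: a + y') oppr0 scaler0 add0r.
  exact: etrans (uT _ _) (esym (uT _ _)).
by rewrite derive_cst addr0.
Unshelve. all: by end_near. Qed.

End levi.

Section torus_average.
Context {R : realType} {n : nat}.
Context (G : pointC R n -> R) (CG : Ck 2 G)
  (G_periodic : forall x, rV_periodic (fun theta => G (x, theta))).

Local Notation F := (fun x : 'rV[R]_n => cube_integral (fun theta => G (x, theta))).

Let cG : continuous G := Ck_continuous CG.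

Lemma continuous_average : continuous F.
Proof.
apply: (@continuous_cube_integral R n _ (fun x theta => G (x, theta))).
by rewrite (_ : (fun z => _) = G) //; apply/funext => -[].
Qed.

Let continuous_G_fiber x : continuous (fun theta => G (x, theta)).
Proof. exact: (@continuous_slice _ _ _ G x cG). Qed.

Let continuous_G_shift x c : continuous (fun theta => G (x, theta + c)).
Proof.
apply: (@continuous_of_comp _ _ _ (fun theta : 'rV[R]_n => theta + c)
  (fun theta => G (x, theta))).
  apply: (@continuous_fun_add R _ _ id (fun=> c)); last exact: cst_continuous.
  by move=> y; exact: cvg_id.
exact: continuous_G_fiber.
Qed.

Let horizontal x a (r : R) theta := G (r *: a + x, theta) + G (- r *: a + x, theta).
Let vertical x a (r : R) theta := G (x, theta + r *: a) + G (x, theta + - r *: a).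

Let continuous_horizontal x a r : continuous (horizontal x a r).
Proof. by apply: continuous_fun_add; exact: continuous_G_fiber. Qed.

Let continuous_vertical x a r : continuous (vertical x a r).
Proof. by apply: continuous_fun_add; exact: continuous_G_shift. Qed.

Let continuous_center x : continuous (fun theta => - 4 * G (x, theta)).
Proof.
apply: (@continuous_fun_scale R _ R^o (fun=> - 4)); first exact: cst_continuous.
exact: continuous_G_fiber.
Qed.

Let continuous_cross x a r :
  continuous (fun theta => horizontal x a r theta + vertical x a r theta).
Proof. by apply: continuous_fun_add. Qed.

(** By periodicity the translates in theta of the integrand have the same
    integral as the integrand itself, so the vertical second difference can be
    inserted; the coefficient - 4 collects the centre of both differences. *)
Lemma average_second_difference x a (r : R) :
  F (r *: a + x) + F (- r *: a + x) - 2 * F x =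
  cube_integral (fun theta =>
    (horizontal x a r theta + vertical x a r theta) + - 4 * G (x, theta)).
Proof.
rewrite (cube_integralD (@continuous_cross x a r) (@continuous_center x)).
rewrite (cube_integralD (@continuous_horizontal x a r) (@continuous_vertical x a r)).
rewrite (cube_integralD (@continuous_G_fiber _) (@continuous_G_fiber _)).
rewrite (cube_integralD (@continuous_G_shift _ _) (@continuous_G_shift _ _)).
rewrite (cube_integralZ _ (@continuous_G_fiber _)).
rewrite !(cube_integral_shift _ (@continuous_G_fiber x) (G_periodic x)).
by ring.
Qed.

Let near_fiber (w : pointC R n) x (e : R) : 0 < e ->
  \forall r \near (0 : R)^'+, forall t, `|t| <= r -> forall theta, cube theta ->
    `|'D_w ('D_w G) (t *: w + (x, theta)) - 'D_w ('D_w G) (x, theta)| <= e.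
Proof.
move=> e0.
pose f (z : R * 'rV[R]_n) := 'D_w ('D_w G) (z.1 *: w + (x, z.2)).
have cf : continuous f.
  apply: (@continuous_of_comp _ _ _
    (fun z : R * 'rV[R]_n => z.1 *: w + (x, z.2) : pointC R n) ('D_w ('D_w G))).
    apply: (@continuous_fun_add R _ (pointC R n)
      (fun z : R * 'rV[R]_n => z.1 *: w) (fun z : R * 'rV[R]_n => (x, z.2))).
      apply: (@continuous_fun_scale R _ (pointC R n) fst (fun=> w)).
        by move=> z; exact: cvg_fst.
      exact: cst_continuous.
    apply: (@continuous_pair _ _ _ (fun=> x) snd); first exact: cst_continuous.
    by move=> z; exact: cvg_snd.
  exact: Ck_continuous (Ck_derive w (Ck_derive w CG)).
have := near0_right (compact_near_uniform 0 (@compact_cube R n) cf e0).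
apply: filterS => r H t tr theta cth.
by have := H t tr theta cth; rewrite /f /= scale0r add0r.
Qed.

(** The integrand in average_second_difference is r^2 times levi G up to an
    error that is small compared with r^2 uniformly on the cube, so Schwarz's
    lemma applies. *)
Lemma average_convex : (forall p v, 0 <= levi G p v) -> convex F.
Proof.
move=> levi0; apply: schwarz_convex => [|x a e e0]; first exact: continuous_average.
(* two second derivatives, each within e' of its value at the centre, are
   integrated over a cube of volume (2 pi)^n *)
pose e' := e / (2 * (2 * pi) ^+ n).
have c0 : 0 < (2 * pi : R) ^+ n by rewrite exprn_gt0 // pi2_gt0.
have e'0 : 0 < e' by rewrite divr_gt0 // mulr_gt0.
apply: filterS3 (nbhs_right_gt 0) (@near_fiber (a, 0) x e' e'0)
  (@near_fiber (0, a) x e' e'0) => r r0 HX HY.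
rewrite average_second_difference.
have -> : - (e * r ^+ 2) = cube_integral (fun _ : 'rV[R]_n => - (2 * e' * r ^+ 2)).
  rewrite cube_integral_cst /e'.
  move: ((2 * pi) ^+ n) c0 => c c0; field; exact: lt0r_neq0.
apply: le_cube_integral.
- exact: cst_continuous.
- exact: (continuous_fun_add (@continuous_cross x a r) (@continuous_center x)).
move=> theta cth.
have [t1 t1r E1] := second_difference ((a, 0) : pointC R n) (x, theta) CG r0.
have [t2 t2r E2] := second_difference ((0, a) : pointC R n) (x, theta) CG r0.
have EX s : s *: ((a, 0) : pointC R n) + (x, theta) = (s *: a + x, theta).
  by rewrite -[LHS]/(s *: a + x, s *: 0 + theta) scaler0 add0r.
have EY s : s *: ((0, a) : pointC R n) + (x, theta) = (x, theta + s *: a).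
  by rewrite -[LHS]/(s *: 0 + x, s *: a + theta) scaler0 add0r addrC.
have := HX t1 t1r theta cth; have := HY t2 t2r theta cth.
have := levi0 (x, theta) (a, 0); rewrite /levi.
have -> : Jmap (a, 0) = (0, a) :> pointC R n by rewrite /Jmap /= oppr0.
move: E1 E2; rewrite !EX !EY.
move: ('D_(a, 0) ('D_(a, 0) G) (t1 *: a + x, theta)) => X1.
move: ('D_(a, 0) ('D_(a, 0) G) (x, theta)) => X0.
move: ('D_(0, a) ('D_(0, a) G) (x, theta + t2 *: a)) => Y1.
move: ('D_(0, a) ('D_(0, a) G) (x, theta)) => Y0.
move=> E1 E2 L0; rewrite !ler_norml => /andP[HY1 _] /andP[HX1 _].
have H : 0 <= r ^+ 2 * (X1 + Y1 + 2 * e').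
  by rewrite mulr_ge0 ?sqr_ge0 //; lra.
move: E1 E2 H; rewrite !(mulrDr (r ^+ 2)); rewrite /horizontal /vertical => <- <-; lra.
Qed.

End torus_average.

Theorem theorem6p1 (R : realType) (n : nat) (h : hermitian_metric R n) :
  (rho_le0 h -> convex (fun x : 'rV[R]_n => VolJ h (torus x)))
  /\
  (Tinvariant h ->
     (rho_le0 h <-> convex (fun x : 'rV[R]_n => ln (VolJ h (torus x))))
     /\
     (rho_ge0 h <-> concave (fun x : 'rV[R]_n => ln (VolJ h (torus x))))).
Proof.
pose u := logH h (@frame R n).
have Cu : Ck 2 u by exact: Ck_logH.
have half0 : 0 < 2^-1 :> R by rewrite invr_gt0.
have rhoE p v : rho h p v (Jmap v) = - 2^-1 * levi u p v by exact: rho_Jmap.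
have leE : rho_le0 h <-> forall p v, 0 <= levi u p v.
  by split => H p v; have := H p v; rewrite rhoE mulNr oppr_le0 pmulr_rge0.
split.
  move=> /leE L.
  rewrite (_ : (fun x => _) =
    fun x => cube_integral (fun theta => expR (2^-1 * u (x, theta))));
    last by apply/funext => x; exact: VolJ_torus.
  apply: (@average_convex R n (fun q => expR (2^-1 * u q))).
  - exact/Ck_exp/CkZ.
  - by move=> x y m; rewrite /u logH_periodic.
  - by move=> p v; exact: levi_expR_ge0.
move=> hT.
have uT x y : u (x, y) = u (x, 0).
  by rewrite /u /logH -[in LHS](add0r y) hT.
have lnV (x : 'rV[R]_n) :
    ln (VolJ h (torus x)) = ln ((2 * pi) ^+ n) + 2^-1 * u (x, 0).
  rewrite VolJ_torus.
  rewrite (_ : (fun theta => _) = fun=> expR (2^-1 * u (x, 0))); last first.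
    by apply/funext => theta; rewrite -/u uT.
  rewrite cube_integral_cst lnM ?expRK // posrE ?expR_gt0 //.
  by rewrite exprn_gt0 // pi2_gt0.
split.
  apply: iff_trans leE (iff_trans (levi_ge0_convex Cu uT) _).
  apply: iff_trans (iff_sym (convex_affine _ (ln ((2 * pi) ^+ n)) half0)) _.
  by apply: convex_ext => x; rewrite lnV.
have geE : rho_ge0 h <-> forall p v, 0 <= levi (fun q => - 1 * u q) p v.
  by split => H p v; have := H p v; rewrite rhoE leviN // mulNr -mulrN pmulr_rge0.
apply: iff_trans geE (iff_trans (levi_ge0_convex (CkZ (- 1) Cu) _) _).
  by move=> x y; rewrite uT.
apply: iff_trans (iff_sym (convex_affine _ (- ln ((2 * pi) ^+ n)) half0)) _.
by apply: convex_ext => x; rewrite lnV opprD mulN1r mulrN.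
Qed.
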